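(* Let $\mathcal{A}=L_0+\mathbb{Q}+L_1+\mathbb{Q}+\cdots+\mathbb{Q}+L_n$ be a countable weakly ultrahomogeneous linear order, where the $L_i$ are finite chains, $L_0$ and $L_n$ are possibly empty, and $|L_i|\ge 2$ for $1\le i\le n-1$. A set $S=\{a_1,\dots,a_m\}$ of special points of $\mathcal{A}$ is exceptional if and only if it satisfies the following conditions: (i) $A\setminus S$ does not include any successor pair; (ii) $S$ contains the last element of each (nonempty) chain among $L_0,\dots,L_{n-1}$ and the first element of each (nonempty) chain among $L_1,\dots,L_n$.
   Context: $A$ is the universe of $\mathcal{A}$, and the language is $\{<\}$. In a linear order, $(a,b)$ is a successor pair if $a<b$ and no $x$ satisfies $a<x<b$; then $a$ and $b$ are called successivities. A special point is an element that is a successivity or an endpoint (a least or greatest element); the set of special points of a linear order $\mathcal{A}=L_0+\mathbb{Q}+L_1+\mathbb{Q}+\cdots+\mathbb{Q}+L_n$, where the $L_i$ are finite chains, $L_0$ and $L_n$ are possibly empty, and $|L_i|\ge 2$ for $1\le i\le n-1$, is $L_0\cup\cdots\cup L_n$. A finite set $S=\{a_1,\dots,a_m\}\subseteq A$ is exceptional if every isomorphism between finite suborders of $\mathcal{A}$ containing $S$ and fixing each element of $S$ extends to an automorphism of $\mathcal{A}$; $\mathcal{A}$ is weakly ultrahomogeneous if it has a (finite) exceptional set. *)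

(* Defs.v *)
From mathcomp Require Import all_boot all_order all_algebra finmap.
From mathcomp Require Import boolp classical_sets cardinality.

Set Implicit Arguments.
Unset Strict Implicit.
Unset Printing Implicit Defensive.

Local Open Scope order_scope.

Section LinearOrder.
Context {d : Order.disp_t} {A : orderType d}.
Implicit Types (a b x : A) (S X Y : {fset A}).

Definition successor_pair a b := a < b /\ ~ exists x, a < x /\ x < b.

Definition successivity a :=
  exists b, successor_pair a b \/ successor_pair b a.

Definition endpoint a := (forall x, a <= x) \/ (forall x, x <= a).

Definition special_point a := successivity a \/ endpoint a.

Definition first_element X a := a \in X /\ forall x, x \in X -> a <= x.

Definition last_element X a := a \in X /\ forall x, x \in X -> x <= a.

(* An isomorphism from X onto Y is given by a total map f : A -> A, of which
   only the restriction to X is relevant. *)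
Definition suborder_iso X Y (f : A -> A) :=
  {in X &, {mono f : x y / x <= y}} /\ [fset f x | x in X]%fset = Y.

Definition order_automorphism (g : A -> A) :=
  bijective g /\ {mono g : x y / x <= y}.

Definition exceptional S :=
  forall X Y (f : A -> A),
    (S `<=` X)%fset -> (S `<=` Y)%fset ->
    suborder_iso X Y f -> {in S, forall a, f a = a} ->
    exists2 g, order_automorphism g & {in X, g =1 f}.

(* A = B 0 + B 1 + ... + B m as an internal sum: the blocks cover A, and are
   arranged in increasing order, which also makes them disjoint. *)
Definition ordered_sum (m : nat) (B : nat -> set A) :=
  (forall a, exists2 k, (k <= m)%N & B k a) /\
  (forall j k a b, (j < k <= m)%N -> B j a -> B k b -> a < b).

Definition rational_chain (Q : set A) :=
  exists2 h : rat -> A, {mono h : x y / x <= y} & range h = Q.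

(* A = L 0 + Q + L 1 + Q + ... + Q + L n, with L 0, ..., L n in the even
   positions and the copies Q 0, ..., Q n.-1 of the rationals in the odd
   positions; the values of L and Q at other indices are irrelevant. *)
Definition chain_rat_sum (n : nat) (L : nat -> {fset A}) :=
  exists2 Q : nat -> set A,
    forall i, (i < n)%N -> rational_chain (Q i) &
    ordered_sum n.*2 (fun k => if odd k then Q k./2 else [set` L k./2]%classic).

End LinearOrder.

Definition weakly_ultrahomogeneous {d : Order.disp_t} (A : orderType d) :=
  exists S : {fset A}, exceptional S.

(* Main.v *)
Require Import Defs.
From mathcomp Require Import all_boot all_order all_algebra finmap.
From mathcomp Require Import boolp classical_sets cardinality.
From mathcomp Require Import ring lra zify.

(** Every element of a chain [L i] is special: it has a neighbour in [L i] when
[L i] has at least two elements, and is an endpoint of the order when it is alone, since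
then [i] is [0] or [n].  No element of a copy of the rationals is special.  So
the special points are the finitely many elements of the chains
([special_pointP]).  An automorphism permutes them and preserves the order,
hence it fixes each of them ([special_point_fixed]).

Necessity.  Suppose [x < y], one of the two points is special, and no element of
[S] lies in the closed interval from [x] to [y].  The map fixing [S] and sending
[x] to [y] is a finite isomorphism; an automorphism extending it would move a
special point.  Hence an exceptional set meets every closed interval with
distinct endpoints of which one is special ([exceptional_separates]).  For a
successor pair this is (i).  For the interval between the last element of a
chain and a point of the following copy of the rationals, or between a point of
such a copy and the first element of the next chain, it is (ii), because the
only special point of that interval is its end in the chain.

Sufficiency.  Conditions (i) and (ii) say that if no element of [S] lies in the
closed interval from [x] to [y], where [x < y], then [x] and [y] belong to the
same copy of the rationals ([separated_or_same_chain]).  A finite isomorphism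
[f] fixing [S] sends each [x] to a point lying on the same side of every element
of [S], so [f x] either equals [x] or lies in the same copy of the rationals as
[x].  Thus [f] acts on each summand separately: as the identity on the chains,
and on each copy of the rationals as a finite isomorphism, which extends by the
ultrahomogeneity of the rationals ([rat_ultrahomogeneous]).  The extensions glue
to an automorphism ([glue_block_automorphisms]). *)

Set Implicit Arguments.
Unset Strict Implicit.
Unset Printing Implicit Defensive.

Import Order.TTheory.

(** * Automorphisms of linear orders *)

Section Automorphisms.
Local Open Scope order_scope.
Context {d : Order.disp_t} {A : orderType d}.
Implicit Types (a b x y : A) (S T X Y : {fset A}) (g : A -> A).

Lemma surj_automorphism g :
  {homo g : x y / x < y} -> (forall y, exists x, g x = y) ->
  order_automorphism g.
Proof.
move=> g_lt /choice[h hK]; have g_mono := le_mono g_lt.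
split=> //; exists h => // x; apply: (inc_inj g_mono); exact: hK.
Qed.

Lemma automorphism_surj g y : order_automorphism g -> exists x, g x = y.
Proof. by move=> [[h _ hK] _]; exists (h y). Qed.

Lemma inv_automorphism g :
  order_automorphism g ->
  exists2 h, order_automorphism h & cancel g h /\ cancel h g.
Proof.
move=> [[h gK hK] g_mono]; exists h => //; split; first by exists g.
by move=> x y; rewrite -g_mono !hK.
Qed.

Lemma glue_automorphism g1 g2 m :
  order_automorphism g1 -> order_automorphism g2 -> g1 m = g2 m ->
  order_automorphism (fun x => if x <= m then g1 x else g2 x).
Proof.
move=> aut1 aut2 eq_m; have [_ mono1] := aut1; have [_ mono2] := aut2.
have lt1 := leW_mono mono1; have lt2 := leW_mono mono2.
apply: surj_automorphism => [x y lt_xy | y].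
  case: (leP x m) => xm; case: (leP y m) => ym; rewrite ?lt1 ?lt2 //.
    by apply: (@le_lt_trans _ _ (g1 m)); rewrite ?mono1 // eq_m lt2.
  by have := lt_trans lt_xy (le_lt_trans ym xm); rewrite ltxx.
case: (leP y (g1 m)) => ym.
  by have [x gx] := automorphism_surj y aut1; exists x; rewrite -mono1 gx ym.
have [x gx] := automorphism_surj y aut2; exists x.
by rewrite -mono2 gx -eq_m leNgt ym.
Qed.

Lemma successor_pair_automorphism g a b :
  order_automorphism g -> successor_pair a b -> successor_pair (g a) (g b).
Proof.
move=> aut [lt_ab nab]; have lt_mono := leW_mono aut.2.
split=> [|[y]]; first by rewrite lt_mono.
have [x <-] := automorphism_surj y aut.
by rewrite !lt_mono => xab; apply: nab; exists x.
Qed.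

Lemma special_point_automorphism g a :
  order_automorphism g -> special_point a -> special_point (g a).
Proof.
move=> aut [[b ab]|ends]; [left; exists (g b) | right].
  by case: ab => /(successor_pair_automorphism aut); [left | right].
by case: ends => ext; [left | right] => y; have [x <-] := automorphism_surj y aut;
   rewrite aut.2.
Qed.

Lemma exists_last_element X a : a \in X -> exists b, last_element X b.
Proof.
move=> aX; case: (@arg_maxP _ _ X [` aX]%fset xpredT val isT) => b _ bmax.
by exists (val b); split=> [|x xX]; [exact: valP | exact: (bmax [` xX]%fset)].
Qed.

Lemma exists_first_element X a : a \in X -> exists b, first_element X b.
Proof.
move=> aX; case: (@arg_minP _ _ X [` aX]%fset xpredT val isT) => b _ bmin.
by exists (val b); split=> [|x xX]; [exact: valP | exact: (bmin [` xX]%fset)].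
Qed.

(** An automorphism [h] cannot raise a special point: the greatest special point
raised by [h] would be sent to a greater one, which [h] raises as well.  Lowering
is excluded by the same argument for the inverse automorphism. *)
Lemma special_point_fixed T g a :
  (forall x, special_point x -> x \in T) -> order_automorphism g ->
  special_point a -> g a = a.
Proof.
move=> specT.
have no_rise h x : order_automorphism h -> special_point x -> ~ x < h x.
  move=> aut xspec xlt.
  pose U := [fset z in T | `[< special_point z >] && (z < h z)]%fset.
  have inU z : special_point z -> z < h z -> z \in U.
    by move=> zs zlt; rewrite !inE /= zlt specT // andbT; apply/asboolP.
  have [b [bU bmax]] := exists_last_element (inU x xspec xlt).
  move: bU; rewrite !inE /= => /and3P[_ /asboolP bs blt].
  have hbU : h b \in U.
    by apply: inU; [exact: special_point_automorphism | rewrite (leW_mono aut.2)].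
  by have := lt_le_trans blt (bmax _ hbU); rewrite ltxx.
move=> aut aspec; case: (ltgtP (g a) a) => // [ga_lt|a_lt]; last first.
  by case: (no_rise g a aut aspec).
have [h haut [gK hK]] := inv_automorphism aut.
by case: (no_rise h a haut aspec); rewrite -(leW_mono aut.2) hK.
Qed.

(** Moving [x] to [y] while fixing [S] is a finite isomorphism, because [x] and
[y] lie on the same side of every element of [S]. *)
Lemma exceptional_move S x y :
  exceptional S -> x < y -> (forall s, s \in S -> ~ (x <= s <= y)) ->
  exists2 g, order_automorphism g & g x = y.
Proof.
move=> excS lt_xy noS; pose f z := if z == x then y else z.
have xS : x \notin S by apply/negP => /noS; rewrite lexx ltW.
have fS s : s \in S -> f s = s.
  by rewrite /f; case: eqP => // -> /noS; rewrite lexx ltW.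
have [||||g aut gf] := excS (x |` S)%fset (y |` S)%fset f.
- exact: fsubsetU1.
- exact: fsubsetU1.
- split.
    have cut s : s \in S -> (s <= y) = (s <= x) /\ (y <= s) = (x <= s).
      move=> sS; have /negP := noS s sS; rewrite negb_and -!ltNge => /orP[] h.
        have h' := lt_trans h lt_xy.
        by rewrite (ltW h) (ltW h') (leNgt y) (leNgt x) h h'.
      have h' := lt_trans lt_xy h.
      by rewrite (leNgt s y) (leNgt s x) h h' !ltW.
    move=> u v; rewrite !inE => /orP[/eqP->|uS] /orP[/eqP->|vS];
      rewrite ?(fS u uS) ?(fS v vS) //; rewrite ?[f x]/f ?eqxx ?lexx //.
      exact: (cut v vS).2.
    exact: (cut u uS).1.
  rewrite imfsetU1 {1}/f eqxx; congr (_ |` _)%fset.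
  apply/fsetP => z; apply/imfsetP/idP => [[s /= sS ->]|zS]; first by rewrite fS.
  by exists z; rewrite ?fS.
- exact: fS.
by exists g => //; rewrite gf ?inE ?eqxx // /f eqxx.
Qed.

(** The source of both necessary conditions: otherwise some automorphism would
carry [x] to [y], although it fixes whichever of them is special. *)
Lemma exceptional_separates S T x y :
  exceptional S -> (forall z, special_point z -> z \in T) ->
  x < y -> special_point x \/ special_point y ->
  exists2 s, s \in S & x <= s <= y.
Proof.
move=> excS specT lt_xy spec; apply: contrapT => noS.
have [|g aut gx] := exceptional_move excS lt_xy.
  by move=> s sS sxy; apply: noS; exists s.
have gfix := special_point_fixed specT aut.
case: spec => /gfix; first by rewrite gx => e; move: lt_xy; rewrite e ltxx.
rewrite -[in RHS]gx => /(inc_inj aut.2) e.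
by move: lt_xy; rewrite e ltxx.
Qed.

End Automorphisms.

(** * Ultrahomogeneity of the rationals *)

Section RationalHomogeneity.
Import GRing.Theory Num.Theory.
Local Open Scope ring_scope.

Lemma affine_automorphism (c b : rat) :
  0 < c -> order_automorphism (fun x : rat => c * x + b).
Proof.
move=> c_gt0; apply: surj_automorphism => [x y|y]; first by rewrite ltrD2r ltr_pM2l.
by exists ((y - b) / c); field; rewrite gt_eqF.
Qed.

(** The extension is built point by point in increasing order: an automorphism
that is correct up to the last point [m] is kept below [m] and replaced above
[m] by the affine map through the values prescribed at [m] and at the next point
[x]. *)
Lemma rat_ultrahomogeneous (s : seq rat) (f : rat -> rat) :
  {in s &, {mono f : x y / x <= y}} ->
  exists2 g, order_automorphism g & {in s, g =1 f}.
Proof.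
pose t := sort <=%O (undup s).
have mem_t : t =i s by move=> x; rewrite mem_sort mem_undup.
have t_sorted : sorted <%O t by rewrite sort_lt_sorted undup_uniq.
move=> f_mono; have {f_mono} f_mono : {in t &, {mono f : x y / x <= y}}.
  by move=> x y; rewrite !mem_t; apply: f_mono.
suff [g aut gf] : exists2 g, order_automorphism g & {in t, g =1 f}.
  by exists g => // x; rewrite -mem_t; apply: gf.
elim/last_ind: t t_sorted f_mono {mem_t} => [|t x IHt] t_sorted f_mono.
  exists id => //; split=> //; exact: inv_bij.
case/lastP: t t_sorted f_mono IHt => [_ _ _|t m].
  (* A single point only needs a translation. *)
  exists (fun y => 1 * y + (f x - x)); first exact: affine_automorphism.
  by move=> y; rewrite inE => /eqP->; ring.
move=> t_sorted f_mono IHt.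
move: t_sorted; rewrite lt_sorted_pairwise pairwise_rcons => /andP[/allP t_lt].
rewrite -lt_sorted_pairwise => t_sorted.
have [//||g aut gf] := IHt.
  by move=> u v ut vt; apply: f_mono; rewrite mem_rcons inE ?ut ?vt orbT.
have m_t : m \in rcons t m by rewrite mem_rcons mem_head.
have m_lt : m < x by apply: t_lt.
have fm_lt : f m < f x.
  by rewrite (leW_mono_in f_mono) ?mem_rcons ?inE ?eqxx ?m_t ?orbT ?m_lt.
pose c := (f x - f m) / (x - m).
have c_gt0 : 0 < c by rewrite divr_gt0 // subr_gt0.
exists (fun y => if y <= m then g y else c * y + (f m - c * m)).
  apply: glue_automorphism => //; first exact: affine_automorphism.
  by rewrite gf //; ring.
move=> y; rewrite mem_rcons inE => /orP[/eqP->|yt].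
  rewrite leNgt m_lt /= /c; field.
  by rewrite subr_eq0 gt_eqF.
have -> : y <= m; last by rewrite gf.
move: yt t_sorted; rewrite lt_sorted_pairwise pairwise_rcons mem_rcons inE.
by case/orP => [/eqP-> //|yt] /andP[/allP/(_ y yt)/ltW].
Qed.

End RationalHomogeneity.

(** * Ordered sums and copies of the rationals *)

Section OrderedSums.
Local Open Scope order_scope.
Context {d : Order.disp_t} {A : orderType d}.
Implicit Types (a b x y : A) (Q : set A) (B : nat -> set A).

(** [g] restricts to an automorphism of [Q] that agrees with [f] on the points of
[X] in [Q]; its values outside [Q] are arbitrary. *)
Definition block_extension Q (X : {fset A}) (f g : A -> A) :=
  [/\ (forall x y, Q x -> Q y -> x < y -> g x < g y),
      (forall x, Q x -> Q (g x)),
      (forall y, Q y -> exists2 x, Q x & g x = y) &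
      (forall x, x \in X -> Q x -> g x = f x)].

Lemma ordered_sum_le m B j k a b :
  ordered_sum m B -> (j <= m)%N -> B j a -> B k b -> a <= b -> (j <= k)%N.
Proof.
move=> [_ Blt] jm Ba Bb ab; rewrite leqNgt; apply/negP => kj.
by have := Blt k j b a; rewrite kj jm ltNge ab => /(_ isT Bb Ba).
Qed.

Lemma ordered_sum_uniq m B j k a :
  ordered_sum m B -> (j <= m)%N -> (k <= m)%N -> B j a -> B k a -> j = k.
Proof.
move=> sumB jm km Bj Bk; apply/eqP; rewrite eqn_leq.
by apply/andP; split; apply: (@ordered_sum_le m B _ _ a a).
Qed.

Lemma ordered_sum_convex m B k a b c :
  ordered_sum m B -> (k <= m)%N -> B k a -> B k c -> a <= b <= c -> B k b.
Proof.
move=> sumB km Ba Bc /andP[ab bc]; have [j jm Bb] := sumB.1 b.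
suff -> : k = j by [].
apply/eqP; rewrite eqn_leq (ordered_sum_le sumB km Ba Bb ab).
exact: (ordered_sum_le sumB jm Bb Bc bc).
Qed.

(** Automorphisms of the summands, applied blockwise, form an automorphism of the
sum: the order between different blocks is preserved because each block is sent
to itself. *)
Lemma glue_block_automorphisms m B (X : {fset A}) f :
  ordered_sum m B ->
  (forall k, (k <= m)%N -> exists g : A -> A, block_extension (B k) X f g) ->
  exists2 g, order_automorphism g & {in X, g =1 f}.
Proof.
move=> sumB loc.
have /choice[K /all_and2[Km BK]] x : exists k, (k <= m)%N /\ B k x.
  by have [k] := sumB.1 x; exists k.
have /choice[H HP] k : exists g : A -> A, (k <= m)%N ->
    block_extension (B k) X f g.
  by case: (leqP k m) => [/loc[g gP]|_]; [exists g | exists id].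
exists (fun x => H (K x) x); last first.
  by move=> x xX; have [_ _ _ ->] := HP _ (Km x).
apply: surj_automorphism => [x y xy|y].
  have [gx_lt gB _ _] := HP _ (Km x); have [_ gB' _ _] := HP _ (Km y).
  have := ordered_sum_le sumB (Km x) (BK x) (BK y) (ltW xy).
  rewrite leq_eqVlt => /orP[/eqP eK|lt_K].
    by rewrite -eK; apply: gx_lt => //; rewrite eK.
  by apply: (sumB.2 (K x) (K y)); rewrite ?lt_K ?Km //; [apply: gB | apply: gB'].
have [_ _ g_surj _] := HP _ (Km y); have [x Bx gx] := g_surj y (BK y).
exists x; suff -> : K x = K y by [].
exact: (ordered_sum_uniq sumB).
Qed.

(** Around a point of [Q] there are points of [Q] arbitrarily close on both
sides.  Convexity ensures that a point [b] of the order which cuts [Q] within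
distance 1 of [h r] is itself in [Q], so that the midpoint can be used; otherwise
[h (r + 1)] or [h (r - 1)] already separates [b] from [h r]. *)
Lemma rational_chain_not_special Q x :
  rational_chain Q -> (forall a b c, Q a -> Q c -> a <= b <= c -> Q b) ->
  Q x -> ~ special_point x.
Proof.
move=> [h h_mono <-] Qconv [r _ <-] {x}; have h_lt := leW_mono h_mono.
have Qh q : range h (h q) by exists q.
have above b : h r < b -> exists y, h r < y /\ y < b.
  move=> rb; case: (leP b (h (r + 1)%R)) => [b_le|lt_b].
    have [|q _ eb] := Qconv (h r) b (h (r + 1)%R) (Qh _) (Qh _).
      by rewrite ltW.
    exists (h ((r + q) / 2)%R); move: rb; rewrite -eb !h_lt => ?.
    by split; lra.
  by exists (h (r + 1)%R); rewrite h_lt; split=> //; lra.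
have below b : b < h r -> exists y, b < y /\ y < h r.
  move=> rb; case: (leP (h (r - 1)%R) b) => [b_le|lt_b].
    have [|q _ eb] := Qconv (h (r - 1)%R) b (h r) (Qh _) (Qh _).
      by rewrite b_le ltW.
    exists (h ((r + q) / 2)%R); move: rb; rewrite -eb !h_lt => ?.
    by split; lra.
  by exists (h (r - 1)%R); rewrite h_lt; split=> //; lra.
case=> [[b []] [lt_b nb]|[r_min|r_max]].
- exact/nb/above.
- exact/nb/below.
- by have := r_min (h (r - 1)%R); rewrite h_mono; lra.
- by have := r_max (h (r + 1)%R); rewrite h_mono; lra.
Qed.

(** Ultrahomogeneity of the rationals, carried along the isomorphism [h] and its
inverse [k]. *)
Lemma rational_chain_extension Q (X : {fset A}) f :
  rational_chain Q ->
  {in X &, {mono f : x y / x <= y}} -> (forall x, x \in X -> Q x -> Q (f x)) ->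
  exists g : A -> A, block_extension Q X f g.
Proof.
move=> [h h_mono hQ] f_mono fQ; have h_lt := leW_mono h_mono.
have Qh q : Q (h q) by rewrite -hQ; exists q.
have /choice[k kK] x : exists q, Q x -> h q = x.
  case: (pselect (Q x)) => [|nQ]; last by exists 0%R.
  by rewrite -hQ => -[q _ <-]; exists q.
have hK : cancel h k by move=> q; apply: (inc_inj h_mono); rewrite kK.
pose s := [seq k x | x <- X & `[< Q x >]].
have [|g aut gf] := @rat_ultrahomogeneous s (k \o f \o h).
  move=> q r /mapP[x + ->] /mapP[y + ->]; rewrite !mem_filter.
  move=> /andP[/asboolP Qx xX] /andP[/asboolP Qy yX] /=.
  by rewrite -!h_mono !kK //; [exact: f_mono | exact: fQ | exact: fQ].
exists (h \o g \o k); split=> [x y Qx Qy xy|x _|y Qy|x xX Qx] /=.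
- by rewrite h_lt (leW_mono aut.2) -h_lt !kK.
- exact: Qh.
- have [q gq] := automorphism_surj (k y) aut; exists (h q) => //=.
  by rewrite hK gq kK.
- rewrite gf /= ?kK //; first exact: fQ.
  by apply/mapP; exists x => //; rewrite mem_filter xX andbT; apply/asboolP.
Qed.

End OrderedSums.

(** * Sums of finite chains and copies of the rationals *)

Section ChainRatSums.
Local Open Scope order_scope.
Context {d : Order.disp_t} {A : orderType d}.
Context (n : nat) (L : nat -> {fset A}) (Q : nat -> set A).
(* The summands in order: chains at even indices, copies of the rationals at
   odd ones. *)
Let B k : set A := if odd k then Q k./2 else [set` L k./2]%classic.
Context (sumB : ordered_sum n.*2 B).
Context (ratQ : forall i, (i < n)%N -> rational_chain (Q i)).
Context (L_gt1 : forall i : nat, (1 <= i)%N -> (i < n)%N -> (2 <= #|` L i|)%N).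
Implicit Types (a b x y : A) (S : {fset A}).

Lemma even_block i a : B i.*2 a = (a \in L i).
Proof. by rewrite /B odd_double doubleK. Qed.

Lemma odd_block i : B i.*2.+1 = Q i.
Proof. by rewrite /B /= odd_double /= uphalf_double. Qed.

Lemma block_cases a :
  (exists2 i, (i <= n)%N & a \in L i) \/ (exists2 i, (i < n)%N & Q i a).
Proof.
have [k kn Bk] := sumB.1 a.
move: kn Bk; rewrite -[k]odd_double_half; case: (odd k) => /=.
  by rewrite add1n odd_block ltn_double => ? ?; right; exists k./2.
by rewrite add0n even_block leq_double => ? ?; left; exists k./2.
Qed.

Lemma chain_convex i a b c :
  (i <= n)%N -> a \in L i -> c \in L i -> a <= b <= c -> b \in L i.
Proof.
rewrite -leq_double -3!even_block => i_le La Lc.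
exact: (ordered_sum_convex sumB i_le La Lc).
Qed.

(** The successor of [a] in a convex finite set is its successor in the whole
order. *)
Lemma chain_successor i a c :
  (i <= n)%N -> a \in L i -> c \in L i -> a < c ->
  exists2 b, b <= c & successor_pair a b.
Proof.
move=> i_le La Lc ac.
have cU : c \in [fset z in L i | a < z]%fset by rewrite !inE /= Lc.
have [b [+ bmin]] := exists_first_element cU.
rewrite !inE /= => /andP[Lb ab]; exists b; first exact: bmin.
split=> // -[x [ax xb]].
have := bmin x; rewrite leNgt xb => /(_ _)/notF; apply.
by rewrite !inE /= ax (chain_convex i_le La Lb) // !ltW.
Qed.

Lemma chain_predecessor i a c :
  (i <= n)%N -> a \in L i -> c \in L i -> a < c ->
  exists b, successor_pair b c.
Proof.
move=> i_le La Lc ac.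
have aU : a \in [fset z in L i | z < c]%fset by rewrite !inE /= La.
have [b [+ bmax]] := exists_last_element aU.
rewrite !inE /= => /andP[Lb bc]; exists b; split=> // -[x [bx xc]].
have := bmax x; rewrite leNgt bx => /(_ _)/notF; apply.
by rewrite !inE /= xc (chain_convex i_le Lb Lc) // !ltW.
Qed.

Lemma block_lt j k a b : (j < k)%N -> (k <= n.*2)%N -> B j a -> B k b -> a < b.
Proof. by move=> jk kn; apply: (sumB.2 j k); rewrite jk. Qed.

Lemma special_pointP a :
  special_point a <-> exists2 i, (i <= n)%N & a \in L i.
Proof.
split=> [spec|[i i_le La]].
  case: (block_cases a) => // -[i i_lt Qa]; exfalso; move: spec.
  apply: (rational_chain_not_special (ratQ i_lt)) Qa => x y z.
  by rewrite -odd_block; apply: (ordered_sum_convex sumB); rewrite ltn_double.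
case: (pselect (exists2 b, b \in L i & b != a)) => [[b Lb]|single].
  rewrite neq_lt => /orP[ba|ab]; left.
    by have [c bc] := chain_predecessor i_le Lb La ba; exists c; right.
  by have [c _ ac] := chain_successor i_le La Lb ab; exists c; left.
have {}single b : b \in L i -> b = a.
  by move=> Lb; apply: contrapT => /eqP ba; apply: single; exists b.
have Li_card : (#|` L i| <= 1)%N.
  rewrite -(cardfs1 a); apply/fsubset_leq_card/fsubsetP => b /single ->.
  by rewrite inE.
(* Inner chains have at least two elements, so this chain is an outer one. *)
have i_end : i = 0%N \/ i = n.
  case: (posnP i) => i_gt0; [by left | right].
  apply/eqP; rewrite eqn_leq i_le leqNgt /=; apply/negP => i_lt.
  by have := leq_trans (L_gt1 i_gt0 i_lt) Li_card.
right; case: i_end => ei; [left | right] => x; have [k kn Bx] := sumB.1 x.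
  case: (posnP k) => k0.
    by move: Bx; rewrite k0 -[0%N]/(0.*2)%N even_block -ei => /single->.
  by apply/ltW; apply: (@block_lt 0 k) => //; rewrite -[0%N]/(0.*2)%N even_block -ei.
move: kn; rewrite leq_eqVlt => /orP[/eqP ek|kn].
  by move: Bx; rewrite ek even_block -ei => /single->.
by apply/ltW; apply: (@block_lt k n.*2) => //; rewrite even_block -ei.
Qed.

Lemma special_points_finite :
  exists T : {fset A}, forall x, special_point x -> x \in T.
Proof.
exists (\bigcup_(i <- iota 0 n.+1) L i)%fset => x /special_pointP[i i_le Lx].
by apply/bigfcupP; exists i => //; rewrite mem_iota /= ltnS i_le.
Qed.

(** * Exceptional sets of special points *)

Section Conditions.
Context (S : {fset A}).

Definition meets_successor_pairs :=
  forall a b : A, successor_pair a b -> ~ (a \notin S /\ b \notin S).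

Definition contains_last_elements :=
  forall (i : nat) (a : A), (i < n)%N -> last_element (L i) a -> a \in S.

Definition contains_first_elements :=
  forall (i : nat) (a : A), (1 <= i)%N -> (i <= n)%N ->
    first_element (L i) a -> a \in S.

Context (S_special : forall a, a \in S -> special_point a).

Lemma exceptional_meets_successor_pairs :
  exceptional S -> meets_successor_pairs.
Proof.
move=> excS a b ab [aS bS]; have [T specT] := special_points_finite.
have [|s sS /andP[as_ sb]] := exceptional_separates excS specT ab.1.
  by left; left; exists b; left.
apply: ab.2; exists s; rewrite !lt_neqAle as_ sb !andbT.
by split; [apply: contraTneq sS => <- | apply: contraTneq sS => ->].
Qed.

Lemma rational_chain_point i : (i < n)%N -> exists x, Q i x.
Proof. by move=> /ratQ[h _ <-]; exists (h 0%R); exists 0%R. Qed.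

(** An element [s] of [S] between [a] and a point of the next copy of the
rationals lies in some chain, by specialness; that chain can only be [L i], where
[a] is greatest, so [s] is [a]. *)
Lemma exceptional_contains_last : exceptional S -> contains_last_elements.
Proof.
move=> excS i a i_lt [La a_max]; have [T specT] := special_points_finite.
have [x Qx] := rational_chain_point i_lt.
have ax : a < x.
  apply: (@block_lt i.*2 i.*2.+1); rewrite ?ltn_double ?even_block //.
  by rewrite odd_block.
have [|s sS /andP[as_ sx]] := exceptional_separates excS specT ax.
  by left; apply/special_pointP; exists i => //; apply: ltnW.
have /special_pointP[j j_le Ls] := S_special sS.
have ij : (i.*2 <= j.*2)%N.
  apply: (ordered_sum_le sumB _ _ _ as_); rewrite ?even_block //.
  by rewrite leq_double ltnW.
have ji : (j.*2 <= i.*2.+1)%N.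
  apply: (ordered_sum_le sumB _ _ _ sx); rewrite ?even_block ?odd_block //.
  by rewrite leq_double.
have eij : j = i by lia.
by rewrite [a](@le_anti _ _ a s) // as_ a_max // -eij.
Qed.

Lemma exceptional_contains_first : exceptional S -> contains_first_elements.
Proof.
move=> excS [//|i] b _ i_lt [Lb b_min]; have [T specT] := special_points_finite.
have [x Qx] := rational_chain_point i_lt.
have xb : x < b.
  apply: (@block_lt i.*2.+1 i.+1.*2); rewrite ?leq_double ?even_block //.
  by rewrite odd_block.
have [|s sS /andP[xs sb]] := exceptional_separates excS specT xb.
  by right; apply/special_pointP; exists i.+1.
have /special_pointP[j j_le Ls] := S_special sS.
have ij : (i.*2.+1 <= j.*2)%N.
  apply: (ordered_sum_le sumB _ _ _ xs); rewrite ?even_block ?odd_block //.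
  by rewrite ltn_double.
have ji : (j.*2 <= i.+1.*2)%N.
  apply: (ordered_sum_le sumB _ _ _ sb); rewrite ?even_block //.
  by rewrite leq_double.
have eij : j = i.+1 by lia.
by rewrite [b](@le_anti _ _ b s) // sb b_min // -eij.
Qed.

Context (Spair : meets_successor_pairs) (Slast : contains_last_elements)
  (Sfirst : contains_first_elements).

(** If [x] is in a chain, either its successor is at most [y] and (i) applies, or
[y] is beyond the chain, whose last element then separates them.  If [x] is in a
copy of the rationals and [y] beyond it, the first element of the next chain
separates them; that chain is empty only at the far right of the order, where no
such [y] exists. *)
Lemma separated_or_same_chain x y :
  x < y -> (exists2 s, s \in S & x <= s <= y) \/
           exists2 i, (i < n)%N & Q i x /\ Q i y.
Proof.
move=> xy; have [[i i_le Lx]|[i i_lt Qx]] := block_cases x; last first.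
  have [k kn By] := sumB.1 y.
  have : (i.*2.+1 <= k)%N.
    apply: (ordered_sum_le sumB _ _ By (ltW xy)); rewrite ?odd_block //.
    by rewrite ltn_double.
  rewrite leq_eqVlt => /orP[/eqP ek|ik].
    by right; exists i => //; rewrite -odd_block ek -{1}ek odd_block.
  left; case: (fset_0Vmem (L i.+1)) => [L0|[a0 La0]].
    (* An empty chain after a copy of the rationals must be the last chain. *)
    have i_n : i.+1 = n.
      apply/eqP; rewrite eqn_leq i_lt leqNgt /=; apply/negP => i_lt'.
      by have := L_gt1 (ltn0Sn i) i_lt'; rewrite L0 cardfs0.
    have ek : k = i.+1.*2 by lia.
    by move: By; rewrite ek even_block L0.
  have [a [La a_min]] := exists_first_element La0.
  exists a; first exact: (@Sfirst i.+1).
  apply/andP; split.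
    apply/ltW/(@block_lt i.*2.+1 i.+1.*2); rewrite ?leq_double ?even_block //.
    by rewrite odd_block.
  have : (i.+1.*2 <= k)%N by lia.
  rewrite leq_eqVlt => /orP[/eqP ek|ak].
    by apply: a_min; rewrite -even_block ek.
  by apply/ltW/(block_lt ak kn) => //; rewrite even_block.
left; case: (boolP (y \in L i)) => [Ly|nLy].
  have [b b_le xb] := chain_successor i_le Lx Ly xy.
  have /not_andP[/negP|/negP] := Spair xb; rewrite negbK => sS.
    by exists x => //; rewrite lexx ltW.
  by exists b => //; rewrite (ltW xb.1).
have [k kn By] := sumB.1 y.
have : (i.*2 <= k)%N.
  apply: (ordered_sum_le sumB _ _ By (ltW xy)); rewrite ?even_block //.
  by rewrite leq_double.
rewrite leq_eqVlt => /orP[/eqP ek|ik].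
  by move: By nLy; rewrite -ek even_block => ->.
have [a [La a_max]] := exists_last_element Lx.
exists a; first by apply: (@Slast i) => //; lia.
rewrite a_max //=; apply/ltW/(block_lt ik kn) => //.
by rewrite even_block.
Qed.

(** Each [x] lies on the same side of every element of [S] as its image, so
[separated_or_same_chain], applied to [x] and [f x] in whichever order they
come, confines the action of [f] to the copies of the rationals. *)
Lemma conditions_exceptional : exceptional S.
Proof.
move=> X Y f SX _ [f_mono _] fS.
have same_chain x : x \in X -> f x = x \/ exists2 i, (i < n)%N & Q i x /\ Q i (f x).
  move=> xX.
  have cut s : s \in S -> (s <= f x) = (s <= x) /\ (f x <= s) = (x <= s).
    move=> sS; have sX := fsubsetP SX s sS.
    by rewrite -{1 3}(fS s sS) !f_mono.
  have eq_s s : s \in S -> s <= x -> x <= s -> f x = x.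
    move=> sS sx xs; have -> : x = s by apply: le_anti; rewrite sx xs.
    exact: fS.
  case: (ltgtP (f x) x) => [lt_fx|lt_xf|]; last by left.
    have [[s sS /andP[fs sx]]|[i i_lt [Qf Qx]]] := separated_or_same_chain lt_fx.
      by left; apply: (eq_s s) => //; rewrite -(cut s sS).2.
    by right; exists i.
  have [[s sS /andP[xs sf]]|[i i_lt [Qx Qf]]] := separated_or_same_chain lt_xf.
    by left; apply: (eq_s s) => //; rewrite -(cut s sS).1.
  by right; exists i.
apply: (glue_block_automorphisms sumB) => k kn.
(* Odd blocks are copies of the rationals, even blocks are chains. *)
have [ek|ek] : k = k./2.*2.+1 \/ k = k./2.*2 by lia.
  move: kn; rewrite ek; move: (k./2) => i i_lt.
  rewrite odd_block; rewrite ltn_double in i_lt.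
  apply: rational_chain_extension (ratQ i_lt) f_mono _ => x xX Qx.
  have [-> //|[j j_lt [Qj Qfj]]] := same_chain x xX.
  suff /eqP : i.*2.+1 = j.*2.+1 by rewrite eqSS => /eqP /double_inj ->.
  by apply: (ordered_sum_uniq sumB (a := x)); rewrite ?ltn_double // odd_block.
exists id; split=> // [y By|x xX]; first by exists y.
move: kn; rewrite ek; move: (k./2) => i i_le.
move=> Bx; have [-> //|[j j_lt [Qj _]]] := same_chain x xX.
suff : odd i.*2 = odd j.*2.+1 by rewrite /= !odd_double.
congr odd; apply: (ordered_sum_uniq sumB (a := x)); rewrite ?ltn_double //.
by rewrite odd_block.
Qed.

End Conditions.
End ChainRatSums.

Theorem proposition3p6 (d : Order.disp_t) (A : orderType d) (n : nat)
    (L : nat -> {fset A}) (S : {fset A}) :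
  countable [set: A]%classic ->
  weakly_ultrahomogeneous A ->
  chain_rat_sum n L ->
  (forall i : nat, 1 <= i -> i < n -> 2 <= #|` L i|) ->
  (forall a : A, a \in S -> special_point a) ->
  exceptional S <->
  ((forall a b : A, successor_pair a b -> ~ (a \notin S /\ b \notin S)) /\
   ((forall (i : nat) (a : A), i < n -> last_element (L i) a -> a \in S) /\
    (forall (i : nat) (a : A), 1 <= i -> i <= n ->
       first_element (L i) a -> a \in S))).
Proof.
move=> _ _ [Q ratQ sumB] L_gt1 S_special; split=> [excS|[Spair [Slast Sfirst]]].
  split; first exact: (exceptional_meets_successor_pairs sumB ratQ L_gt1).
  split; first exact: (exceptional_contains_last sumB ratQ L_gt1).
  exact: (exceptional_contains_first sumB ratQ L_gt1).
exact: (conditions_exceptional sumB ratQ L_gt1).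
Qed.
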